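(* Let $n\ge 1$, let $\mathcal{D}_n\subseteq\mathcal{M}_n$ be the family of $n\times n$ complex diagonal matrices and let $\mathcal{B}_n\subseteq\mathcal{M}_n$ be the family of $n\times n$ complex principally balanced matrices. Then $\mathcal{D}_n$ and $\mathcal{B}_n$ form a multiplicative finite free complementary pair, i.e. $\mathcal{D}_n^{\boxtimes}=\mathcal{B}_n$ and $\mathcal{B}_n^{\boxtimes}=\mathcal{D}_n$.
   Context: $\mathcal{M}_n=\mathbb{C}^{n\times n}$ and $\chi_A(x)=\det(xI-A)$. For polynomials $p(x)=\sum_{k=0}^n a_kx^{n-k}$ and $q(x)=\sum_{k=0}^n b_kx^{n-k}$ of degree $n$ over $\mathbb{C}$, the multiplicative convolution is $p(x)\boxtimes q(x)=\sum_{k=0}^n\frac{(-1)^k}{\binom{n}{k}}a_kb_kx^{n-k}$. Matrices $A,B\in\mathcal{M}_n$ are in multiplicative finite free position (multiplicative FFP) if $\chi_{AB}(x)=\chi_A(x)\boxtimes\chi_B(x)$. For $\mathcal{A}\subseteq\mathcal{M}_n$, $\mathcal{A}^{\boxtimes}$ is the set of all $B\in\mathcal{M}_n$ such that $\chi_{AB}(x)=\chi_A(x)\boxtimes\chi_B(x)$ for every $A\in\mathcal{A}$. Sets $\mathcal{E},\mathcal{F}\subseteq\mathcal{M}_n$ form a multiplicative finite free complementary pair if $\mathcal{E}^{\boxtimes}=\mathcal{F}$ and $\mathcal{F}^{\boxtimes}=\mathcal{E}$. A matrix $B\in\mathcal{M}_n$ is principally balanced if for every $1\le i\le n$ all principal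 minors of $B$ of order $i$ have the same value. *)

(* Defs.v *)
From HB Require Import structures.
From mathcomp Require Import all_boot all_order all_algebra.
From mathcomp Require Import complex.
From mathcomp Require Import boolp classical_sets reals.

Set Implicit Arguments.
Unset Strict Implicit.
Unset Printing Implicit Defensive.

Import GRing.Theory Num.Theory.

Local Open Scope ring_scope.
Local Open Scope classical_set_scope.

(* The a_k of p(x) = \sum_k a_k x^(n-k) is the coefficient p`_(n - k). The
   degree n is an explicit argument, as the operation depends on it. *)
Definition mulconv (F : numFieldType) (n : nat) (p q : {poly F}) : {poly F} :=
  \sum_(k < n.+1)
    ((-1) ^+ k / 'C(n, k)%:R * p`_(n - k) * q`_(n - k)) *: 'X^(n - k).

Definition mul_ffp (F : numFieldType) (n : nat) (A B : 'M[F]_n) : Prop :=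
  char_poly (A *m B) = mulconv n (char_poly A) (char_poly B).

Definition mul_ffp_dual (F : numFieldType) (n : nat) (E : set 'M[F]_n) :
    set 'M[F]_n :=
  [set B | forall A, E A -> mul_ffp A B].

Definition mul_ff_complementary_pair (F : numFieldType) (n : nat)
    (E G : set 'M[F]_n) : Prop :=
  mul_ffp_dual E = G /\ mul_ffp_dual G = E.

(* For S : {set 'I_n}, enum_val lists the elements of S in increasing order. *)
Definition principal_minor (F : numFieldType) (n : nat) (B : 'M[F]_n)
    (S : {set 'I_n}) : F :=
  \det (\matrix_(i < #|S|, j < #|S|) B (enum_val i) (enum_val j)).

Definition principally_balanced (F : numFieldType) (n : nat) (B : 'M[F]_n) :
    Prop :=
  forall i : nat, (1 <= i <= n)%N ->
  forall S T : {set 'I_n}, #|S| = i -> #|T| = i ->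
    principal_minor B S = principal_minor B T.

Definition diagonal_matrices (F : numFieldType) (n : nat) : set 'M[F]_n :=
  [set A | is_diag_mx A].

Definition principally_balanced_matrices (F : numFieldType) (n : nat) :
    set 'M[F]_n :=
  [set B | principally_balanced B].

Arguments diagonal_matrices F n : clear implicits.
Arguments principally_balanced_matrices F n : clear implicits.

(* Main.v *)
Require Import Defs.
From mathcomp Require Import all_boot all_order all_algebra.
From mathcomp Require Import complex.
From mathcomp Require Import boolp classical_sets reals.

Set Implicit Arguments.
Unset Strict Implicit.
Unset Printing Implicit Defensive.

Import GRing.Theory Num.Theory.

Local Open Scope ring_scope.
Local Open Scope complex_scope.

(** Write e_k(M) for the sum of the principal minors of order k of M. The
    coefficient of x^(n-k) in the characteristic polynomial of M is
    (-1)^k e_k(M) (char_poly_coef), so A and B are in multiplicative finite free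
    position exactly when e_k(AB) = e_k(A) e_k(B) / C(n,k) for all k <= n
    (mul_ffpP). The rest is a matter of choosing test matrices.

    For D = diag(d), the principal minor of DB on S is that of B on S times the
    product of the d_i for i in S, and so e_k(DB) is a weighted sum of the minors
    of B of order k. If these all equal b, then e_k(DB) = b e_k(D) and
    e_k(B) = C(n,k) b, which is the required identity (mul_ffp_diag_balanced).
    Conversely, taking for d the indicator of a set S of size k isolates the
    minor of B on S and forces it to be e_k(B) / C(n,k), whatever S
    (balanced_of_mul_ffp_diag). Hence the dual of the diagonal matrices is the
    set of principally balanced ones.

    In the other direction, transposition exchanges the two factors of a
    product, preserves every e_k, and preserves both families; so diagonal
    matrices lie in the dual of the balanced ones. Finally a matrix unit E_ji
    with i != j has all its principal minors of positive order equal to 0, hence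
    is balanced. The identity for k = 1 with this matrix reads tr(E_ji A) = 0,
    that is A_ij = 0 (diag_of_mul_ffp_delta). *)

(** * Expansion of det(x + M) into principal minors *)

(** Sylvester's identity: the block matrix [1, -U; V, 1] can be reduced to block
    triangular form by eliminating either of its two identity blocks. *)
Lemma det_add1_mulC (R : comNzRingType) (m n : nat)
    (U : 'M[R]_(m, n)) (V : 'M[R]_(n, m)) :
  \det (1%:M + U *m V) = \det (1%:M + V *m U).
Proof.
pose L := block_mx 1%:M 0 V 1%:M : 'M_(m + n).
pose K := block_mx 1%:M (- U) V 1%:M : 'M_(m + n).
have KL : K = L *m block_mx 1%:M (- U) 0 (1%:M + V *m U).
  by rewrite mulmx_block !mul1mx !mul0mx !mulmx1 !addr0 mulmxN addrCA addNr addr0.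
have KU : K = block_mx (1%:M + U *m V) (- U) 0 1%:M *m L.
  by rewrite mulmx_block !mul1mx !mul0mx !mulmx1 mulmx0 !add0r mulNmx addrK.
transitivity (\det K).
  by rewrite KU det_mulmx det_ublock det_lblock !det1 !mulr1.
by rewrite KL det_mulmx det_ublock det_lblock !det1 !mul1r.
Qed.

(** The determinant is additive in each row: expand every row of A + B. *)
Lemma det_addmx (R : comNzRingType) (n : nat) (A B : 'M[R]_n) :
  \det (A + B) =
  \sum_(S : {set 'I_n}) \det (\matrix_(i, j) if i \in S then A i j else B i j).
Proof.
rewrite [RHS]exchange_big /=; apply: eq_bigr => s _; rewrite -mulr_sumr; congr (_ * _).
under eq_bigr do rewrite mxE.
rewrite bigA_distr; apply: eq_bigr => S _; apply: eq_bigr => i _.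
by rewrite mxE.
Qed.

(** With P the matrix of the inclusion of S into all the indices, the matrix on
    the left is 1 + P Q, where Q consists of the rows of M - 1 indexed by S. By
    Sylvester's identity its determinant is that of 1 + Q P, and this is the
    submatrix of M on S. No permutation of the rows into block form, nor any
    relabelling of permutations in the Leibniz formula, has to be carried out. *)
Lemma det_rows_off_identity (R : comNzRingType) (n : nat) (M : 'M[R]_n)
    (S : {set 'I_n}) :
  \det (\matrix_(i, j) if i \in S then M i j else (1%:M : 'M[R]_n) i j) =
  \det (mxsub (enum_val : 'I_#|S| -> _) enum_val M).
Proof.
pose f := enum_val : 'I_#|S| -> 'I_n.
pose P : 'M[R]_(n, #|S|) := colsub f 1%:M.
have PE (V : 'M[R]_n) i j : (P *m rowsub f V) i j = if i \in S then V i j else 0.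
  rewrite mxE; transitivity (\sum_(k in S) (i == k)%:R * V k j).
    by rewrite [RHS]big_enum_val; apply: eq_bigr => k _; rewrite !mxE.
  case: ifP => iS; last first.
    by rewrite big1 // => k kS; case: eqP kS => [<-|]; rewrite ?iS ?mul0r.
  rewrite (bigD1 i) //= eqxx mul1r big1 ?addr0 // => k /andP[_ ki].
  by rewrite eq_sym (negPf ki) mul0r.
transitivity (\det (1%:M + P *m rowsub f (M - 1%:M))).
  congr (\det _); apply/matrixP => i j; rewrite mxE [in RHS]mxE PE.
  by case: ifP => _; rewrite !mxE ?addr0 // addrC subrK.
rewrite det_add1_mulC -mxsub_mul mulmx1; congr (\det _).
apply/matrixP => i j; rewrite !mxE (inj_eq enum_val_inj).
by rewrite addrC subrK.
Qed.

Lemma det_scalar_add (R : comNzRingType) (n : nat) (x : R) (M : 'M[R]_n) :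
  \det (x%:M + M) =
  \sum_(S : {set 'I_n})
     x ^+ (n - #|S|) * \det (mxsub (enum_val : 'I_#|S| -> _) enum_val M).
Proof.
rewrite addrC det_addmx; apply: eq_bigr => S _.
rewrite -det_rows_off_identity.
pose d : 'rV[R]_n := \row_i if i \in S then 1 else x.
have -> : x ^+ (n - #|S|) = \det (diag_mx d).
  rewrite det_diag (bigID (mem S)) /= big1 => [|i iS]; last by rewrite mxE iS.
  rewrite mul1r (eq_bigr (fun=> x)) => [|i iS]; last by rewrite mxE (negPf iS).
  rewrite prodr_const; congr (_ ^+ _).
  have := congr1 (subn^~ #|S|) (cardC (mem S)).
  by rewrite /= addKn card_ord => ->.
rewrite -det_mulmx mul_diag_mx; congr (\det _); apply/matrixP => i j.
by rewrite !mxE; case: ifP => _; rewrite ?mul1r // mulr_natr.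
Qed.

(** * Characteristic polynomials and principal minors *)

Section PrincipalMinors.
Variables (F : numFieldType) (n : nat).
Implicit Types (A B M : 'M[F]_n) (S : {set 'I_n}).

Definition sum_principal_minors (k : nat) M : F :=
  \sum_(S : {set 'I_n} | #|S| == k) principal_minor M S.

Lemma principal_minorE M S :
  principal_minor M S = \det (mxsub (enum_val : 'I_#|S| -> _) enum_val M).
Proof. by congr (\det _); apply/matrixP => i j; rewrite !mxE. Qed.

Lemma principal_minor_trmx M S : principal_minor M^T S = principal_minor M S.
Proof.
rewrite -[RHS]det_tr; congr (\det _); apply/matrixP => i j.
by rewrite !mxE.
Qed.

Lemma principal_minor_diag_mul (d : 'rV[F]_n) M S :
  principal_minor (diag_mx d *m M) S = (\prod_(i in S) d 0 i) * principal_minor M S.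
Proof.
rewrite big_enum_val !principal_minorE.
pose e : 'rV_#|S| := \row_i d 0 (enum_val i).
transitivity (\det (diag_mx e *m mxsub (enum_val : 'I_#|S| -> _) enum_val M)).
  by rewrite !mul_diag_mx; congr (\det _); apply/matrixP => i j; rewrite !mxE.
by rewrite det_mulmx det_diag; congr (_ * _); apply: eq_bigr => i _; rewrite mxE.
Qed.

Lemma principal_minor_diag (d : 'rV[F]_n) S :
  principal_minor (diag_mx d) S = \prod_(i in S) d 0 i.
Proof.
rewrite -[diag_mx d]mulmx1 principal_minor_diag_mul principal_minorE.
suff -> : mxsub (enum_val : 'I_#|S| -> _) enum_val (1%:M : 'M[F]_n) = 1%:M.
  by rewrite det1 mulr1.
by apply/matrixP => i j; rewrite !mxE (inj_eq enum_val_inj).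
Qed.

Lemma char_poly_coef M (k : nat) : (k <= n)%N ->
  (char_poly M)`_(n - k) = (-1) ^+ k * sum_principal_minors k M.
Proof.
move=> kn; rewrite /char_poly /char_poly_mx det_scalar_add coef_sum mulr_sumr.
rewrite [RHS]big_mkcond /=; apply: eq_bigr => S _.
have -> : \det (mxsub (enum_val : 'I_#|S| -> _) enum_val (- map_mx polyC M)) =
    ((-1) ^+ #|S| * principal_minor M S)%:P.
  rewrite principal_minorE rmorphM rmorphXn rmorphN1 -det_map_mx map_mxsub.
  by rewrite -detZ; congr (\det _); apply/matrixP => i j; rewrite !mxE mulN1r.
have Sn : (#|S| <= n)%N by rewrite -[leqRHS]card_ord max_card.
rewrite coefMC coefXn.
have -> : (n - k == n - #|S|)%N = (#|S| == k).
  by rewrite eq_sym; apply/eqP/eqP => [/(congr1 (subn n))|->//]; rewrite !subKn.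
by case: eqP => [->|_]; rewrite ?mul1r ?mul0r.
Qed.

Lemma coef_mulconv (p q : {poly F}) (k : nat) : (k <= n)%N ->
  (mulconv n p q)`_(n - k) = (-1) ^+ k / 'C(n, k)%:R * p`_(n - k) * q`_(n - k).
Proof.
move=> kn; rewrite coef_sum (bigD1 (Ordinal (kn : (k < n.+1)%N))) //=.
rewrite coefZ coefXn eqxx mulr1 big1 ?addr0 // => i ik.
rewrite coefZ coefXn; case: eqP => [e|_]; last by rewrite mulr0.
case/eqP: ik; apply: val_inj; move/(congr1 (subn n)): e => /=.
by rewrite !subKn // -ltnS.
Qed.

Lemma size_mulconv (p q : {poly F}) : (size (mulconv n p q) <= n.+1)%N.
Proof.
apply: (leq_trans (size_sum _ _ _)); apply/bigmax_leqP => i _.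
by rewrite (leq_trans (size_scale_leq _ _)) // size_polyXn ltnS leq_subr.
Qed.

(** Comparing the coefficients of x^(n-k): on the right, the two factors and the
    convolution each contribute a sign (-1)^k, of which a single one remains to
    cancel that of the characteristic polynomial of AB. *)
Lemma mul_ffpP A B :
  mul_ffp A B <-> forall k, (k <= n)%N ->
    sum_principal_minors k (A *m B) =
    sum_principal_minors k A * sum_principal_minors k B / 'C(n, k)%:R.
Proof.
have coefE k : (k <= n)%N ->
    (mulconv n (char_poly A) (char_poly B))`_(n - k) =
    (-1) ^+ k *
      (sum_principal_minors k A * sum_principal_minors k B / 'C(n, k)%:R).
  move=> kn; rewrite coef_mulconv // !char_poly_coef // -!mulrA; congr (_ * _).
  rewrite (mulrCA (sum_principal_minors k A)) [X in _ * X]mulrA.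
  by rewrite -expr2 sqrr_sign mul1r mulrC mulrA.
split=> [AB k kn|AB].
  have sign_neq0 : (-1) ^+ k != 0 :> F by rewrite signr_eq0.
  apply: (mulfI sign_neq0).
  by rewrite -coefE // -char_poly_coef // AB.
apply/polyP => i; case: (leqP i n) => [le_in|lt_ni].
  by rewrite -(subKn le_in) char_poly_coef ?coefE ?leq_subr // AB ?leq_subr.
rewrite !nth_default // ?size_char_poly //.
exact: leq_trans (size_mulconv _ _) lt_ni.
Qed.

Lemma sum_principal_minors_trmx k M :
  sum_principal_minors k M^T = sum_principal_minors k M.
Proof. by apply: eq_bigr => S _; rewrite principal_minor_trmx. Qed.

(** The convolution is commutative, and M and M^T have the same principal
    minors. *)
Lemma mul_ffp_trmx A B : mul_ffp B^T A^T -> mul_ffp A B.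
Proof.
move=> /mul_ffpP BA; apply/mul_ffpP => k kn; have := BA k kn.
by rewrite -trmx_mul !sum_principal_minors_trmx mulrC => ->; rewrite mulrC [_ B * _]mulrC.
Qed.

(** This is the identity for k = 1, read off the coefficient of x^(n-1). *)
Lemma mul_ffp_mxtrace A B : (0 < n)%N ->
  mul_ffp A B -> \tr (A *m B) = \tr A * \tr B / n%:R.
Proof.
move=> n_gt0 /(congr1 (fun p : {poly F} => p`_(n - 1))) /=.
rewrite coef_mulconv // subn1 !char_poly_trace // bin1 expr1 mulN1r.
by rewrite -mulrA mulrNN mulNr => /oppr_inj ->; rewrite mulrC.
Qed.

(** * Diagonal matrices against principally balanced matrices *)

Lemma principally_balanced_trmx M :
  principally_balanced M -> principally_balanced M^T.
Proof.
move=> balM k kn S T Sk Tk.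
by rewrite !principal_minor_trmx; apply: balM Sk Tk.
Qed.

(** A common value b of the minors of order k comes out of the weighted sum
    giving e_k(DB). *)
Lemma mul_ffp_diag_balanced (d : 'rV[F]_n) B :
  principally_balanced B -> mul_ffp (diag_mx d) B.
Proof.
move=> balB; apply/mul_ffpP => k kn.
have [b bE] : exists b, forall S : {set 'I_n}, #|S| = k -> principal_minor B S = b.
  have : (0 < #|[set S : {set 'I_n} | #|S| == k]|)%N.
    by rewrite card_draws card_ord bin_gt0.
  case/card_gt0P => T; rewrite inE => /eqP Tk; exists (principal_minor B T).
  (* Balancedness only speaks of orders k >= 1; for k = 0 both sets are empty. *)
  move=> S Sk; case: (posnP k) Sk Tk => [->|k_gt0] Sk Tk.
    by rewrite (cards0_eq Sk) (cards0_eq Tk).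
  by apply: (balB k) => //; rewrite k_gt0.
have -> : sum_principal_minors k B = b * 'C(n, k)%:R.
  rewrite /sum_principal_minors (eq_bigr (fun=> b)) => [|S /eqP]; last exact: bE.
  by rewrite sumr_const mulr_natr -[in RHS](card_ord n) -card_draws cardsE.
rewrite mulrA mulfK ?pnatr_eq0 -?lt0n ?bin_gt0 // mulr_suml.
apply: eq_bigr => S /eqP Sk.
by rewrite principal_minor_diag_mul principal_minor_diag bE.
Qed.

(** Among the sets of the size of S, only S itself survives the weights given by
    its own indicator; this is what lets a diagonal 0-1 matrix select a single
    principal minor. *)
Lemma prod_indicator (S T : {set 'I_n}) : #|S| = #|T| ->
  \prod_(i in T) ((i \in S)%:R : F) = (T == S)%:R.
Proof.
move=> ST; rewrite eqEcard ST leqnn andbT.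
case: (boolP (T \subset S)) => [/fintype.subsetP sTS|/fintype.subsetPn[i iT iS]].
  by rewrite big1 // => i /sTS ->.
by rewrite (bigD1 i) //= (negPf iS) mul0r.
Qed.

(** Testing B against the indicator of S shows that its minor on S depends only
    on the size of S. *)
Lemma balanced_of_mul_ffp_diag B :
  (forall d : 'rV[F]_n, mul_ffp (diag_mx d) B) -> principally_balanced B.
Proof.
move=> ffpB k /andP[_ kn].
suff minorE S : #|S| = k ->
    principal_minor B S = sum_principal_minors k B / 'C(n, k)%:R.
  by move=> S T /minorE -> /minorE ->.
move=> Sk; pose d : 'rV[F]_n := \row_i (i \in S)%:R.
have dE (T : {set 'I_n}) : #|T| == k -> \prod_(i in T) d 0 i = (T == S)%:R.
  move=> /eqP Tk; rewrite -prod_indicator ?Sk ?Tk //.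
  by apply: eq_bigr => i _; rewrite mxE.
have sumE (f : {set 'I_n} -> F) :
    \sum_(T : {set 'I_n} | #|T| == k) (\prod_(i in T) d 0 i) * f T = f S.
  rewrite (bigD1 S) ?Sk //= dE ?Sk // eqxx mul1r big1 ?addr0 //.
  by move=> T /andP[Tk /negPf TS]; rewrite dE // TS mul0r.
have /mul_ffpP/(_ k kn) := ffpB d.
have -> : sum_principal_minors k (diag_mx d *m B) = principal_minor B S.
  by rewrite -sumE; apply: eq_bigr => T _; rewrite principal_minor_diag_mul.
have -> : sum_principal_minors k (diag_mx d) = 1.
  rewrite -[RHS](sumE (fun=> 1)); apply: eq_bigr => T _.
  by rewrite principal_minor_diag mulr1.
by rewrite mul1r.
Qed.

(** Off-diagonal matrix units, and all their principal submatrices, square to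
    zero. *)
Lemma principally_balanced_delta_mx (i j : 'I_n) :
  i != j -> principally_balanced (delta_mx i j : 'M[F]_n).
Proof.
move=> ij k /andP[k_gt0 _].
suff minor0 S : #|S| = k -> principal_minor (delta_mx i j : 'M[F]_n) S = 0.
  by move=> S T /minor0 -> /minor0 ->.
move=> Sk; rewrite principal_minorE; set N := mxsub _ _ _.
(* A nonempty square submatrix whose square vanishes has determinant 0. *)
have NN : N *m N = 0.
  apply/matrixP => a b; rewrite !mxE big1 // => c _; rewrite !mxE.
  case: (eqVneq (enum_val c) j) => [->|_]; last by rewrite andbF mul0r.
  by rewrite [j == i]eq_sym (negPf ij) mulr0.
have : \det N ^+ 2 = 0.
  rewrite expr2 -det_mulmx NN.
  by move: k_gt0; rewrite -Sk; case: #|S| => // m _; rewrite det0.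
by move/eqP; rewrite expf_eq0 => /eqP.
Qed.

(** As E_ji has trace 0, the trace of E_ji A, which is the entry A_ij, must
    vanish. *)
Lemma diag_of_mul_ffp_delta A :
  (forall i j : 'I_n, i != j -> mul_ffp (delta_mx i j) A) -> is_diag_mx A.
Proof.
move=> ffpA; apply/is_diag_mxP => i j ij.
have n_gt0 : (0 < n)%N by apply: leq_ltn_trans (ltn_ord i).
have trE (M : 'M[F]_n) : \tr (delta_mx j i *m M) = M i j.
  rewrite /mxtrace (bigD1 j) //= big1 => [|a aj].
    rewrite addr0 mxE (bigD1 i) //= big1 => [|b bi].
      by rewrite addr0 mxE !eqxx mul1r.
    by rewrite mxE (negPf bi) andbF mul0r.
  by rewrite mxE big1 // => b _; rewrite mxE (negPf aj) mul0r.
have ji : j != i by rewrite eq_sym.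
have := mul_ffp_mxtrace n_gt0 (ffpA j i ji).
by rewrite trE -[delta_mx j i]mulmx1 trE mxE [i == j]eq_sym (negPf ji) !mul0r.
Qed.

End PrincipalMinors.

Theorem theorem6p11 (R : realType) (n : nat) (hn : (1 <= n)%N) :
  mul_ff_complementary_pair
    (diagonal_matrices R[i] n) (principally_balanced_matrices R[i] n).
Proof.
split; apply/seteqP; split => B.
- move=> ffpB; apply: balanced_of_mul_ffp_diag => d.
  by apply: ffpB; apply: diag_mx_is_diag.
- by move=> balB _ /diag_mxP[d ->]; apply: mul_ffp_diag_balanced.
- move=> ffpB; apply: diag_of_mul_ffp_delta => i j ij.
  by apply: ffpB; apply: principally_balanced_delta_mx.
(* Here the balanced matrix is the left factor: transpose to move it right. *)
- move=> /diag_mxP[d ->] A balA; apply: mul_ffp_trmx; rewrite tr_diag_mx.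
  by apply: mul_ffp_diag_balanced; apply: principally_balanced_trmx.
Qed.
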